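(* Let $n$ be a positive integer and let $\ell=\ell(n)$ satisfy $\ell=o(n)$. Pick a permutation $\sigma$ uniformly at random from the symmetric group $S_{2^n}$ acting on $\{0,1\}^n$, and let $\pi=\sigma\circ X_1$, where $X_1:\{0,1\}^n\to\{0,1\}^n$ flips the first bit of a string. Let $D_\sigma$ be the distribution on $\{0,1\}^n$ obtained as follows: start with the string $0^n$, then $\ell$ times independently apply either $\sigma$ or $\pi$, each with probability $1/2$, and output the resulting string. Suppose one is given a string $y\in\{0,1\}^n$ which is either drawn from $D_\sigma$ or else drawn uniformly from $\{0,1\}^n$. Then, given $y$ and black-box (quantum) query access to $\sigma$ and $\sigma^{-1}$, no quantum algorithm can determine which of the two cases holds with probability greater than $2/3$ using fewer than $2^{\Omega(\ell)}$ quantum queries to $\sigma$ and $\sigma^{-1}$. Here the success probability is taken over the random choice of $\sigma$, the choice of $y$, and the internal randomness of the algorithm.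
   Context: Query access to a permutation $\tau$ of $\{0,1\}^n$ means access to the unitary oracle $\mathcal{O}_\tau:\lvert x\rangle\lvert z\rangle\mapsto \lvert x\rangle\lvert z\oplus\tau(x)\rangle$ for $x,z\in\{0,1\}^n$, which may be applied in superposition; the algorithm has such access to both $\tau=\sigma$ and $\tau=\sigma^{-1}$, and each application of either oracle counts as one query. *)

(* Defs.v *)
From mathcomp Require Import all_boot all_algebra all_fingroup complex.
From mathcomp Require Import reals Rstruct.
From Stdlib Require Import Rpower.
Set Implicit Arguments. Unset Strict Implicit. Unset Printing Implicit Defensive.
Import GRing.Theory Num.Theory.
Local Open Scope ring_scope.

Notation RR := Rdefinitions.R.
Notation CC := (RR[i]).

Definition bits (n : nat) := {ffun 'I_n -> bool}.
Definition zero_str (n : nat) : bits n := [ffun _ => false].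
Definition xor_str n (a b : bits n) : bits n := [ffun i => addb (a i) (b i)].
Definition flip1 n (x : bits n) : bits n :=
  [ffun i => if val i == 0%N then ~~ x i else x i].

Definition pi_of n (s : {perm bits n}) (x : bits n) : bits n := s (flip1 x).

Fixpoint walk_from n (s : {perm bits n}) (ws : seq bool) (x : bits n) : bits n :=
  match ws with
  | [::] => x
  | b :: ws' => walk_from s ws' (if b then s x else pi_of s x)
  end.
Definition walk n l (s : {perm bits n}) (w : {ffun 'I_l -> bool}) : bits n :=
  walk_from s (fgraph w) (zero_str n).

Definition D_sigma n l (s : {perm bits n}) (y : bits n) : RR :=
  (#|[set w : {ffun 'I_l -> bool} | walk s w == y]|)%:R / (2 ^ l)%:R.

Definition unif n (y : bits n) : RR := 1 / (2 ^ n)%:R.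

(* Basis states: query input register x, answer register z, a control bit b
   selecting the oracle (true: sigma, false: sigma^{-1}), and a workspace
   register with m.+1 basis states. *)
Definition qstate n m := (bits n * bits n * bool * 'I_m.+1)%type.

(* linear operators on C^{qstate}, as matrices indexed by basis states:
   A s t = <s|A|t> *)
Definition op (S : finType) := S -> S -> CC.
Definition vec (S : finType) := S -> CC.
Definition apply_op (S : finType) (A : op S) (v : vec S) : vec S :=
  fun s => \sum_(t : S) A s t * v t.
Definition unitary (S : finType) (U : op S) : Prop :=
  forall s t : S, \sum_(u : S) (U u s)^* * U u t = (s == t)%:R.
Definition basis_vec (S : finType) (s0 : S) : vec S := fun s => (s == s0)%:R.

(* One query: |x, z, b, w> |-> |x, z xor tau_b(x), b, w>, with
   tau_true = sigma, tau_false = sigma^{-1}. (Applying O_sigma or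
   O_{sigma^{-1}}, possibly coherently controlled; one query.) *)
Definition oracle n m (s : {perm bits n}) : op (qstate n m) :=
  fun t u =>
    let: (x, z, b, w) := u in
    (t == (x, xor_str z (if b then s x else (s^-1)%g x), b, w))%:R.

(* A T-query algorithm with workspace of size m.+1. Everything may depend on
   the given string y: unitaries U_0, ..., U_T and the accepting set of basis
   states for the final computational-basis measurement.  The run is
   U_T O U_{T-1} ... O U_1 O U_0 |0^n, 0^n, false, 0>. *)
Record qalg (n T m : nat) := QAlg {
  qU : bits n -> nat -> op (qstate n m);
  qU_unitary : forall y i, (i <= T)%N -> unitary (qU y i);
  qacc : bits n -> {set qstate n m}
}.

Definition init_state n m : qstate n m := (zero_str n, zero_str n, false, ord0).

Fixpoint run_state n T m (A : qalg n T m) (s : {perm bits n}) (y : bits n)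
    (k : nat) : vec (qstate n m) :=
  match k with
  | 0 => apply_op (qU A y 0) (basis_vec (init_state n m))
  | k'.+1 => apply_op (qU A y k) (apply_op (oracle s) (run_state A s y k'))
  end.

Definition sqnorm (z : CC) : RR := complex.Re z ^+ 2 + complex.Im z ^+ 2.

(* probability that A outputs "drawn from D_sigma" (i.e. accepts) *)
Definition accept_prob n T m (A : qalg n T m) (s : {perm bits n}) (y : bits n)
  : RR := \sum_(t in qacc A y) sqnorm (run_state A s y T t).

Definition success_D n l T m (A : qalg n T m) : RR :=
  (#|{perm bits n}|%:R)^-1 *
  \sum_(s : {perm bits n}) \sum_(y : bits n) D_sigma l s y * accept_prob A s y.

Definition success_U n T m (A : qalg n T m) : RR :=
  (#|{perm bits n}|%:R)^-1 *
  \sum_(s : {perm bits n}) \sum_(y : bits n) unif y * (1 - accept_prob A s y).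

(* Main.v *)
Require Import Defs.
From mathcomp Require Import all_boot all_order all_algebra all_fingroup complex.
From mathcomp Require Import reals Rstruct ring lra zify.
From Stdlib Require Import Rpower.
Set Implicit Arguments. Unset Strict Implicit. Unset Printing Implicit Defensive.

(** Split the choices of the walk as [c0 :: w1 ++ rev w2], where [w1] and [w2]
    have about half of the length.  For [s] and [y] uniform and independent,
    follow [w1] forwards from the start to a point [u], follow [w2] backwards
    from [y] to a point [v], and multiply [s] by a transposition so that [u] is
    sent to [v].  Unless the path meets itself, this is the inverse of
    resampling [s] at the midpoint of the walk, so the modified permutation
    together with [y] is distributed almost as in the case where [y] is drawn
    from [D_sigma].  The modification is visible only in queries at [u], [s u],
    [v] and [s^-1 v].  For most [s] the [2 ^ size w1] forward and the
    [2 ^ size w2] backward points are pairwise distinct, so [T] queries put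
    weight [O(T / 2 ^ (l / 2))] on these four points, and the hybrid argument
    bounds the advantage unless [T ^ 2] is of order [2 ^ (l / 2)]. *)

(** * Walks along a uniformly random permutation *)

(* Replacing the fresh value [s (Q s)] by an arbitrary value [r] outside
   [s @: H s] does not disturb [H], [Q] and [Tg], so [(s, r)] can be recovered
   from the modified permutation. *)
Lemma card_fresh_query (B : finType) (t : nat) (H : {perm B} -> seq B)
    (Q Tg : {perm B} -> B) :
  (forall s, size (H s) <= t) ->
  (forall s s' : {perm B}, {in H s, s' =1 s} ->
     [/\ H s' = H s, Q s' = Q s & Tg s' = Tg s]) ->
  #|[set s : {perm B} | (Q s \notin H s) && (s (Q s) == Tg s)]| * (#|B| - t)
    <= #|{perm B}|.
Proof.
move=> sH det.
set E := [set s | _].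
pose P := [set sr : {perm B} * B | (sr.1 \in E) && (sr.2 \notin map sr.1 (H sr.1))].
pose f (sr : {perm B} * B) : {perm B} := (sr.1 * tperm (sr.1 (Q sr.1)) sr.2)%g.
have fH sr : sr \in P -> {in H sr.1, f sr =1 sr.1}.
  rewrite !inE => /andP[/andP[/= QH _] rH] x xH; rewrite /f permM tpermD //.
    by rewrite (inj_eq perm_inj); apply: contraNneq QH => ->.
  by apply: contraNneq rH => ->; rewrite map_f.
have f_inj : {in P &, injective f}.
  move=> [s r] [s' r'] Ps Ps' ff'.
  have [/= H1 Q1 T1] := det _ _ (fH _ Ps); have [/= H2 Q2 T2] := det _ _ (fH _ Ps').
  have QQ : Q s = Q s' by rewrite -Q1 -Q2 ff'.
  have TT : Tg s = Tg s' by rewrite -T1 -T2 ff'.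
  move: Ps Ps'; rewrite !inE /= => /andP[/andP[_ /eqP sT] _] /andP[/andP[_ /eqP sT'] _].
  have rr : r = r'.
    by move/permP/(_ (Q s)): (ff'); rewrite /f /= !permM tpermL QQ tpermL.
  congr (_, _) => //; move: ff'; rewrite /f /= sT sT' -TT -rr.
  exact: mulIg.
have : #|P| <= #|{perm B}|.
  by rewrite -(card_in_imset f_inj) max_card.
apply: leq_trans.
rewrite -[leqRHS]sum1_card [leqRHS](eq_bigl (fun sr : {perm B} * B => (sr.1 \in E) && (sr.2 \notin map sr.1 (H sr.1))));
  last by move=> sr; rewrite inE.
rewrite -(pair_big_dep (mem E) (fun s r => r \notin map s (H s)) (fun _ _ => 1)) /=.
rewrite -sum_nat_const; apply: leq_sum => s _.
rewrite sum1_card leq_subLR -(cardC (mem (map s (H s)))) leq_add //.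
  by rewrite (leq_trans (card_size _)) // size_map.
Qed.

(** [L m] is the [m]-th query of a deterministic adaptive algorithm with access to the
    permutation. *)
Definition adaptive (B : finType) (L : nat -> {perm B} -> B) :=
  forall m (s s' : {perm B}), (forall i, i < m -> s' (L i s) = s (L i s)) -> L m s' = L m s.

(** Union bound over the time [m] of a fresh query and the target [j] hit by its answer. The factor
    [#|B| - K], a lower bound for the number of values still free, avoids division. *)
Lemma card_fresh_union (B : finType) (K J : nat) (L : nat -> {perm B} -> B)
    (Tg : nat -> nat -> {perm B} -> B) :
  adaptive L ->
  (forall m j (s s' : {perm B}), (forall i, i < m -> s' (L i s) = s (L i s)) ->
     Tg m j s' = Tg m j s) ->
  #|[set s : {perm B} | [exists m : 'I_K, exists j : 'I_J,
      [forall i : 'I_m, L i s != L m s] && (s (L m s) == Tg m j s)]]| * (#|B| - K)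
    <= K * J * #|{perm B}|.
Proof.
move=> adL adT.
pose E (m : 'I_K) (j : 'I_J) := [set s : {perm B} |
  (L m s \notin [seq L i s | i <- iota 0 m]) && (s (L m s) == Tg m j s)].
have EK m j : #|E m j| * (#|B| - K) <= #|{perm B}|.
  apply: card_fresh_query => [s|s s' ss'].
    by rewrite size_map size_iota ltnW.
  have agree i : i < m -> s' (L i s) = s (L i s).
    by move=> im; apply: ss'; rewrite map_f // mem_iota.
  split; [|exact: adL|exact: adT].
  apply/eq_in_map => i; rewrite mem_iota /= => im; apply: adL => k ki.
  by apply: agree; exact: ltn_trans im.
set X := [set s | _].
have XE : X \subset \bigcup_m \bigcup_j E m j.
  apply/subsetP => s; rewrite inE => /existsP[m /existsP[j /andP[/forallP fr sT]]].
  apply/bigcupP; exists m => //; apply/bigcupP; exists j => //; rewrite inE sT andbT.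
  apply/negP => /mapP[k]; rewrite mem_iota /= => km Lm.
  by have := fr (Ordinal km); rewrite /= Lm eqxx.
apply: (@leq_trans (\sum_(m < K) \sum_(j < J) #|E m j| * (#|B| - K))); last first.
  apply: (@leq_trans (\sum_(m < K) \sum_(j < J) #|{perm B}|)).
    by apply: leq_sum => m _; apply: leq_sum => j _.
  by rewrite !sum_nat_const !card_ord mulnA.
under eq_bigr => m _ do rewrite -big_distrl.
rewrite -big_distrl leq_mul2r; apply/orP; right.
apply: (leq_trans (subset_leq_card XE)).
elim/big_ind2: _ => [|? ? ? ? h1 h2|m _]; first by rewrite cards0.
  by rewrite (leq_trans (leq_card_setU _ _)) // leq_add.
elim/big_ind2: _ => [|? ? ? ? h1 h2|j _] //; first by rewrite cards0.
by rewrite (leq_trans (leq_card_setU _ _)) // leq_add.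
Qed.

Section Walks.
Variable n : nat.
Local Notation B := (bits n).
Implicit Types (s : {perm bits n}) (c : nat -> bool) (q x y : bits n).

Definition flip_unless (b : bool) x : B := if b then x else flip1 x.

Lemma flip1K : involutive (@flip1 n).
Proof. by move=> x; apply/ffunP => i; rewrite !ffunE; case: eqP; rewrite ?negbK. Qed.

Lemma flip1_neq x : 0 < n -> flip1 x != x.
Proof.
move=> n0; apply/eqP => /ffunP/(_ (Ordinal n0)); rewrite ffunE /=.
by case: (x _).
Qed.

Lemma flip_unlessK b : involutive (flip_unless b).
Proof. by case: b => //; exact: flip1K. Qed.

(** The points are inputs of [s], so the flip of each choice comes after [s]. As flips are
    involutions, reading a walk backwards gives a trail of the inverse permutation. *)
Fixpoint trail s c q (m : nat) : B :=
  if m is m'.+1 then flip_unless (c m') (s (trail s c q m')) else q.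

Lemma trail_adaptive c q : adaptive (fun m s => trail s c q m).
Proof.
move=> m s s'; elim: m => //= m IH agree.
by rewrite IH ?agree // => i im; apply: agree; exact: ltnW.
Qed.

Lemma eq_trail s c c' q m :
  (forall i, i < m -> c i = c' i) -> trail s c q m = trail s c' q m.
Proof.
elim: m => //= m IH cc; rewrite cc // IH // => i im; apply: cc; exact: ltnW.
Qed.

(** At the first repetition, say of point [i] at time [j.+1], the query at time [j] is fresh and its
    answer hits the flipped copy of the earlier point [i]. *)
Lemma card_trail_repeat c q K :
  #|[set s : {perm B} | [exists i : 'I_K, exists j : 'I_K,
      (i != j) && (trail s c q i == trail s c q j)]]| * (#|B| - K)
  <= K * K * #|{perm B}|.
Proof.
pose L m s := trail s c q m.
(* Indices [j > m] get a default target built from [L 0], so that every target is fixed by the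
   answers before time [m]. *)
pose Tg m j s := flip_unless (c m) (L (if j <= m then j else 0) s).
have adL : adaptive L by exact: trail_adaptive.
have adT m j (s s' : {perm B}) : (forall i, i < m -> s' (L i s) = s (L i s)) ->
    Tg m j s' = Tg m j s.
  move=> agree; rewrite /Tg; congr flip_unless; apply: adL => i ij; apply: agree.
  by move: ij; case: ifP => // jm ij; exact: leq_trans jm.
apply: leq_trans (card_fresh_union K K adL adT); rewrite leq_mul2r; apply/orP; right.
apply/subset_leq_card/subsetP => s; rewrite !inE => /existsP[i0 /existsP[j0 /andP[nij eij]]].
have ex : exists j, (j < K) && [exists i : 'I_j, L i s == L j s].
  wlog: i0 j0 nij eij / i0 < j0 => [W|lt].
    case: (ltngtP i0 j0) => [lt|lt|e]; first exact: W lt.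
      by apply: W lt; rewrite eq_sym.
    by move: nij; rewrite (val_inj e) eqxx.
  by exists j0; rewrite ltn_ord; apply/existsP; exists (Ordinal lt).
case: (ex_minnP ex) => -[|j] /andP[jK /existsP[i /eqP Lij]] jmin; first by case: i Lij.
have mK : j < K by exact: ltnW.
apply/existsP; exists (Ordinal mK); apply/existsP.
exists (Ordinal (leq_trans (ltn_ord i) mK)); apply/andP; split.
  apply/forallP => k; apply/negP => kj.
  have : j.+1 <= j by apply: jmin; rewrite mK; apply/existsP; exists k.
  by rewrite ltnn.
by rewrite /Tg /= -ltnS ltn_ord Lij /L /= flip_unlessK.
Qed.

(** Undo equal choices from the end by injectivity; [j] is the last index where the choices
    disagree, and there the two answers must differ by a flip. *)
Lemma trail_collision s c c' q k i : i < k -> c i <> c' i ->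
  trail s c q k = trail s c' q k ->
  exists2 j, j < k & s (trail s c q j) = flip1 (s (trail s c' q j)).
Proof.
elim: k => // k IH ik cc /=.
case: (eqVneq (c k) (c' k)) => ck.
  rewrite -ck => /(inv_inj (flip_unlessK _))/perm_inj e.
  have {}ik : i < k.
    move: ik; rewrite ltnS leq_eqVlt => /orP[/eqP ik|//].
    by case: cc; rewrite ik.
  by have [j jk h] := IH ik cc e; exists j => //; exact: ltnW.
move=> e; exists k => //; move: e ck; rewrite /flip_unless.
by case: (c k); case: (c' k) => //= e _; rewrite -e ?flip1K.
Qed.


(** Follow one trail and then the other as a single sequence of [k.*2] queries. A collision makes
    two answers differ by a flip, so their inputs are distinct, and the one first queried later is
    fresh with a target already known. *)
Lemma card_trail_collision c c' q k i : 0 < n -> i < k -> c i <> c' i ->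
  #|[set s : {perm B} | trail s c q k == trail s c' q k]| * (#|B| - k.*2)
  <= k.*2 * k.*2 * #|{perm B}|.
Proof.
move=> n0 ik cc.
pose L m s := if m < k then trail s c q m else trail s c' q (m - k).
pose Tg m j s := if j < m then flip1 (s (L j s)) else q.
have adL : adaptive L.
  move=> m s s' agree; rewrite /L; case: ltnP => mk; apply: trail_adaptive => j jm.
    by have := agree j jm; rewrite /L (ltn_trans jm mk).
  by have := agree (k + j) ltac:(lia); rewrite /L ltnNge leq_addr addKn.
have adT m j (s s' : {perm B}) : (forall i, i < m -> s' (L i s) = s (L i s)) ->
    Tg m j s' = Tg m j s.
  move=> agree; rewrite /Tg; case: ifP => // jm; congr flip1.
  rewrite (adL j s s') ?agree // => i' ij; apply: agree; exact: ltn_trans jm.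
apply: leq_trans (card_fresh_union _ _ adL adT); rewrite leq_mul2r; apply/orP; right.
apply/subset_leq_card/subsetP => s; rewrite !inE => /eqP /(trail_collision ik cc) [j jk].
have [i1 i1K ->] : exists2 i1, i1 < k.*2 & trail s c q j = L i1 s.
  by exists j; [lia|rewrite /L jk].
have [i2 i2K ->] : exists2 i2, i2 < k.*2 & trail s c' q j = L i2 s.
  by exists (k + j); [lia|rewrite /L ltnNge leq_addr addKn].
(* reduce to the first times at which the two points are queried *)
have first i0 : i0 < k.*2 -> exists m : 'I_k.*2,
    L m s = L i0 s /\ forall i, i < m -> L i s != L m s.
  move=> i0K; have ex : exists m, (m < k.*2) && (L m s == L i0 s).
    by exists i0; rewrite i0K eqxx.
  case: (ex_minnP ex) => m /andP[mK /eqP Lm] mmin; exists (Ordinal mK); split => //=.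
  move=> i' im; apply/negP => /eqP e; have := mmin i'.
  by rewrite e Lm eqxx (ltn_trans im mK) => /(_ isT); rewrite leqNgt im.
have [m1 [<- m1P]] := first _ i1K; have [m2 [<- m2P]] := first _ i2K.
move=> sflip; have : m1 != m2 :> nat.
  apply/eqP => e; move: sflip; rewrite e => /esym/eqP.
  by rewrite (negPf (flip1_neq _ n0)).
rewrite neq_ltn => /orP[lt|lt]; apply/existsP.
  exists m2; apply/existsP; exists m1; rewrite /Tg lt sflip flip1K eqxx andbT.
  by apply/forallP => i'; apply: m2P.
exists m1; apply/existsP; exists m2; rewrite /Tg lt sflip eqxx andbT.
by apply/forallP => i'; apply: m1P.
Qed.


Lemma trail_shift s c q m :
  trail s c q m.+1 = trail s (fun i => c i.+1) (flip_unless (c 0) (s q)) m.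
Proof. by elim: m => //= m <-. Qed.

(** The first choice precedes every query and only affects the starting point; the others act
    between consecutive queries. *)
Lemma walk_from_trail s (c0 : bool) (t : seq bool) x :
  walk_from s (c0 :: t) x = s (trail s (nth false t) (flip_unless c0 x) (size t)).
Proof.
elim: t c0 x => [|c1 t IH] c0 x; first by case: c0.
have -> : walk_from s [:: c0, c1 & t] x = walk_from s (c1 :: t) (s (flip_unless c0 x)).
  by case: c0.
by rewrite IH [size _]/= trail_shift.
Qed.

(** * Rewiring at the midpoint and its inverse *)

Definition start (c0 : bool) : B := flip_unless c0 (zero_str n).

Definition fwd_mid s (c0 : bool) (w1 : seq bool) : B :=
  trail s (nth false w1) (start c0) (size w1).

(** This is an output of [s], whereas [fwd_mid] is an input; hence the preimage taken in
    [rewire]. *)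
Definition bwd_mid s y (w2 : seq bool) : B :=
  trail (s^-1)%g (nth false w2) y (size w2).

(* The modification of [s] whose walk with choices [c0 :: w1 ++ rev w2] is
   meant to end in [y]: the midpoint reached forwards from the start is sent to
   the midpoint reached backwards from [y]. *)
Definition rewire s (c0 : bool) (w1 w2 : seq bool) y : {perm B} :=
  (tperm (fwd_mid s c0 w1) ((s^-1)%g (bwd_mid s y w2)) * s)%g.

(** Index [size w1] is the midpoint; [w2] is reversed because [bwd_mid] reads it from the end of the
    walk. *)
Definition path_pt s (c0 : bool) (w1 w2 : seq bool) (i : nat) : B :=
  trail s (nth false (w1 ++ rev w2)) (start c0) i.

Lemma walk_from_path s (c0 : bool) w1 w2 : walk_from s (c0 :: w1 ++ rev w2) (zero_str n) =
  s (path_pt s c0 w1 w2 (size w1 + size w2)).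
Proof. by rewrite walk_from_trail size_cat size_rev. Qed.

(** The second component of [sp] is the input to be exchanged with the midpoint. It may be the
    midpoint itself, and then the exchange does nothing. *)
Definition good_pair (c0 : bool) (w1 w2 : seq bool) (sp : {perm B} * B) : bool :=
  [forall i : 'I_(size w1 + size w2).+1, (i != size w1 :> nat) ==>
     (path_pt sp.1 c0 w1 w2 i != path_pt sp.1 c0 w1 w2 (size w1)) &&
     (path_pt sp.1 c0 w1 w2 i != sp.2)].

Definition unwire (c0 : bool) (w1 w2 : seq bool) (sp : {perm B} * B) : {perm B} * B :=
  ((tperm (path_pt sp.1 c0 w1 w2 (size w1)) sp.2 * sp.1)%g,
   sp.1 (path_pt sp.1 c0 w1 w2 (size w1 + size w2))).

(** The transposition moves only the midpoint and [p], which the path avoids elsewhere. So the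
    modified permutation still finds the same midpoint from both sides, and [rewire] applies the
    same transposition again. *)
Lemma rewire_unwire (c0 : bool) w1 w2 s p : good_pair c0 w1 w2 (s, p) ->
  let sy := unwire c0 w1 w2 (s, p) in
  rewire sy.1 c0 w1 w2 sy.2 = s /\ (sy.1^-1)%g (bwd_mid sy.1 sy.2 w2) = p.
Proof.
move=> /forallP good /=.
pose a := size w1; pose b := size w2.
pose Q i := path_pt s c0 w1 w2 i; set u := path_pt s c0 w1 w2 _.
have {}good i : i <= a + b -> i != a -> tperm u p (Q i) = Q i.
  move=> ile ia; have := good (Ordinal (ile : i < (a + b).+1)).
  by rewrite /= ia /= => /andP[h1 h2]; rewrite tpermD // eq_sym.
set r := (tperm u p * s)%g.
have rQ i : i <= a + b -> i != a -> r (Q i) = s (Q i).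
  by move=> ile ia; rewrite permM good.
have fE : fwd_mid r c0 w1 = u.
  rewrite /u /path_pt; transitivity (trail s (nth false w1) (start c0) a).
    apply: trail_adaptive => i ia.
    have -> : trail s (nth false w1) (start c0) i = Q i.
      by apply: eq_trail => j ji; rewrite nth_cat (ltn_trans ji ia).
    by rewrite rQ //; move: ia; rewrite -/a; lia.
  by apply: eq_trail => j ji; rewrite nth_cat ji.
rewrite -/a -/b -/(Q _).
(* Going back [j <= b] steps uses only inputs of index above [a], where [r] and [s] agree. *)
have bE j : j <= b -> trail (r^-1)%g (nth false w2) (s (Q (a + b))) j = s (Q (a + b - j)).
  elim: j => [|j IH] jb /=; first by rewrite subn0.
  rewrite IH; last exact: ltnW.
  rewrite -rQ; [|lia|lia]; rewrite permK.
  have -> : a + b - j = (a + b - j.+1).+1 by lia.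
  rewrite /Q /path_pt /=.
  have -> : nth false (w1 ++ rev w2) (a + b - j.+1) = nth false w2 j.
    have ab : (a + b - j.+1 < size w1) = false by rewrite -/a; lia.
    rewrite nth_cat ab nth_rev -/a -/b; last by lia.
    by congr nth; lia.
  by rewrite flip_unlessK.
have vE : bwd_mid r (s (Q (a + b))) w2 = s u.
  by rewrite /bwd_mid bE // addnK.
have rp : r p = s u by rewrite permM tpermR.
rewrite vE -rp permK; split=> //.
by rewrite /rewire fE vE -rp permK /r mulgA tperm2 mul1g.
Qed.

Lemma unwire_inj (c0 : bool) w1 w2 :
  {in [set sp | good_pair c0 w1 w2 sp] &, injective (unwire c0 w1 w2)}.
Proof.
move=> [s p] [s' p']; rewrite !inE => /rewire_unwire /= [h1 h2] /rewire_unwire /= [h1' h2'].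
case=> e1 e2.
by congr (_, _); [rewrite -h1 -h1' e1 e2|rewrite -h2 -h2' e1 e2].
Qed.

(** A pair is bad either because its second component is one of at most [K] path points, or because
    the path of [s] repeats a point. *)
Lemma card_bad_pair (c0 : bool) w1 w2 K : K = (size w1 + size w2).+1 ->
  #|[set sp | ~~ good_pair c0 w1 w2 sp]| * (#|B| - K) <=
  (K * #|{perm B}|) * (#|B| - K) + #|B| * (K * K * #|{perm B}|).
Proof.
move=> defK; pose Q s i := path_pt s c0 w1 w2 i.
pose R := [set s : {perm B} | [exists i : 'I_K, exists j : 'I_K,
      (i != j) && (Q s i == Q s j)]].
have RK : #|R| * (#|B| - K) <= K * K * #|{perm B}| by exact: card_trail_repeat.
have aK : size w1 < K by rewrite defK ltnS leq_addr.
pose P (s : {perm B}) := [set p | p \in [seq Q s i | i <- iota 0 K]].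
have sub : [set sp | ~~ good_pair c0 w1 w2 sp] \subset
    [set sp : {perm B} * B | sp.2 \in P sp.1] :|: setX R setT.
  apply/subsetP => -[s p]; rewrite !inE /= andbT negb_forall -defK => /existsP[k].
  rewrite negb_imply => /andP[ka]; rewrite negb_and !negbK => /orP[/eqP e|/eqP /= e].
    apply/orP; right; apply/existsP; exists k; apply/existsP; exists (Ordinal aK).
    by rewrite -val_eqE ka /Q e eqxx.
  apply/orP; left; rewrite -e (map_f (Q s)) // mem_iota; exact: (ltn_ord k).
have PK : #|[set sp : {perm B} * B | sp.2 \in P sp.1]| <= K * #|{perm B}|.
  rewrite -sum1_card (eq_bigl (fun sp : {perm B} * B => true && (sp.2 \in P sp.1)));
    last by move=> sp; rewrite inE.
  rewrite -(pair_big_dep predT (fun s p => p \in P s) (fun _ _ => 1)) /=.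
  rewrite mulnC -sum_nat_const; apply: leq_sum => s _; rewrite sum1_card.
  by rewrite cardsE (leq_trans (card_size _)) // size_map size_iota.
have := leq_trans (subset_leq_card sub) (leq_card_setU _ _).
rewrite cardsX cardsT => le; apply: leq_trans (leq_mul le (leqnn _)) _.
rewrite mulnDl leq_add // ?leq_mul2r ?PK ?orbT //.
by rewrite [#|R| * _]mulnC -mulnA leq_mul2l RK orbT.
Qed.

(** * Collisions between choice sequences *)

Definition collisions s q k : nat :=
  #|[set ww : k.-tuple bool * k.-tuple bool | (ww.1 != ww.2) &&
     (trail s (nth false ww.1) q k == trail s (nth false ww.2) q k)]|.

(** Pair one element of the fibre with all the others. The bound does not depend on [x], so it
    covers every point that an algorithm may query. *)
Lemma card_fiber_le (W : finType) (g : W -> B) x :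
  #|[set w | g w == x]| <=
  1 + #|[set ww : W * W | (ww.1 != ww.2) && (g ww.1 == g ww.2)]|.
Proof.
have [->|[w0 w0x]] := set_0Vmem [set w | g w == x]; first by rewrite cards0.
rewrite (cardsD1 w0) w0x leq_add2l.
have inj : injective (fun w : W => (w0, w)) by move=> w w' [].
rewrite -(card_imset _ inj) subset_leq_card //; apply/subsetP => _ /imsetP[w + ->].
move: w0x; rewrite !inE /= => /eqP -> /andP[ww0 /eqP ->].
by rewrite eq_sym ww0 eqxx.
Qed.

Lemma sum_collisions q k : 0 < n ->
  (\sum_s collisions s q k) * (#|B| - k.*2) <=
  2 ^ k * 2 ^ k * (k.*2 * k.*2 * #|{perm B}|).
Proof.
move=> n0; have -> : \sum_s collisions s q k = \sum_(ww : k.-tuple bool * k.-tuple bool | ww.1 != ww.2)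
    #|[set s : {perm B} | trail s (nth false ww.1) q k == trail s (nth false ww.2) q k]|.
  rewrite /collisions; under eq_bigr => s _ do rewrite -sum1_card big_mkcond.
  rewrite exchange_big [RHS]big_mkcond /=; apply: eq_bigr => ww _.
  rewrite -sum1_card; case: ifP => ww12; last by rewrite big1 // => s _; rewrite inE ww12.
  by rewrite [RHS]big_mkcond /=; apply: eq_bigr => s _; rewrite !inE ww12.
rewrite big_distrl /=.
apply: (@leq_trans (\sum_(ww : k.-tuple bool * k.-tuple bool) k.*2 * k.*2 * #|{perm B}|)).
  rewrite big_mkcond /=; apply: leq_sum => -[w w'] _ /=; case: ifP => // ww'.
  have [i ik] : exists2 i, i < k & nth false w i <> nth false w' i.
    have /existsP[i /eqP ne] : [exists i : 'I_k, tnth w i != tnth w' i].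
      apply: contraT => /existsPn h; case/negP: ww'; apply/eqP/eq_from_tnth => i.
      by apply/eqP; rewrite -[_ == _]negbK h.
    by exists i => //; rewrite -!tnth_nth.
  exact: card_trail_collision.
by rewrite sum_nat_const card_prod !card_tuple card_bool.
Qed.

End Walks.

Import Order.TTheory GRing.Theory Num.Theory.
Local Open Scope ring_scope.

(** * The hybrid argument *)

Definition nrm2 (S : finType) (v : vec S) : RR := \sum_t sqnorm (v t).

Lemma sqnorm_ge0 z : 0 <= sqnorm z.
Proof. by rewrite addr_ge0 // sqr_ge0. Qed.

Lemma sqnormC z : (sqnorm z)%:C%C = z^* * z.
Proof.
case: z => a b; rewrite /sqnorm /=; apply/eqP; rewrite eq_complex /=.
by apply/andP; split; apply/eqP; ring.
Qed.

Lemma sqnormN z : sqnorm (- z) = sqnorm z.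
Proof. by case: z => a b; rewrite /sqnorm /= !sqrrN. Qed.

(** The right side minus the left is the squared modulus of [x - k * y]. This is the triangle
    inequality for squares with weights [1 + 1/k] and [1 + k], cleared of denominators. *)
Lemma sqnormD_le (k : RR) (x y : CC) : 0 < k ->
  k * sqnorm (x + y) <= (k + 1) * sqnorm x + k * (k + 1) * sqnorm y.
Proof.
case: x y => a b [c d] k0; rewrite /sqnorm /= -subr_ge0.
have -> : (k + 1) * (a ^+ 2 + b ^+ 2) + k * (k + 1) * (c ^+ 2 + d ^+ 2) -
  k * ((a + c) ^+ 2 + (b + d) ^+ 2) = (a - k * c) ^+ 2 + (b - k * d) ^+ 2 by ring.
by rewrite addr_ge0 // sqr_ge0.
Qed.

Lemma nrm2_ge0 (S : finType) (v : vec S) : 0 <= nrm2 v.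
Proof. by apply: sumr_ge0 => t _; exact: sqnorm_ge0. Qed.

Lemma nrm2_unitary (S : finType) (U : op S) (v : vec S) :
  unitary U -> nrm2 (apply_op U v) = nrm2 v.
Proof.
move=> Uu; apply: (@complexI RR); rewrite /nrm2 !rmorph_sum /=.
under eq_bigr => t _ do rewrite sqnormC /apply_op rmorph_sum /= big_distrlr /=.
rewrite exchange_big /=; apply: eq_bigr => r _; rewrite exchange_big /=.
transitivity (\sum_r' (v r)^* * v r' * (r == r')%:R).
  apply: eq_bigr => r' _; rewrite -Uu mulr_sumr; apply: eq_bigr => t _.
  by rewrite rmorphM /=; ring.
rewrite (bigD1 r) //= eqxx mulr1 big1 ?addr0 ?sqnormC // => r' /negPf rr'.
by rewrite eq_sym rr' mulr0.
Qed.

Lemma apply_opB (S : finType) (U : op S) (v w : vec S) t :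
  apply_op U (fun s => v s - w s) t = apply_op U v t - apply_op U w t.
Proof. by rewrite /apply_op -sumrB; apply: eq_bigr => s _; rewrite mulrBr. Qed.

Definition tau n (s : {perm bits n}) (b : bool) : bits n -> bits n :=
  if b then s else (s^-1)%g.

(** On basis states the oracle is this involution, so its action on vectors is a reindexing. *)
Definition orc n m (s : {perm bits n}) (t : qstate n m) : qstate n m :=
  let: (x, z, b, w) := t in (x, xor_str z (tau s b x), b, w).

Lemma orcK n m (s : {perm bits n}) : involutive (@orc n m s).
Proof.
move=> [[[x z] b] w] /=; congr (_, _, _, _).
by apply/ffunP => i; rewrite !ffunE -addbA addbb addbF.
Qed.

Lemma apply_oracle n m (s : {perm bits n}) (v : vec (qstate n m)) t :
  apply_op (oracle s) v t = v (orc s t).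
Proof.
have oE u : oracle s t u = (u == orc s t)%:R.
  have -> : (u == orc s t) = (t == orc s u).
    by rewrite -(inj_eq (inv_inj (@orcK n m s))) orcK eq_sym.
  by case: u => [[[x z] b] w]; rewrite /oracle /= /tau; case: b.
rewrite /apply_op (bigD1 (orc s t)) //= oE eqxx mul1r big1 ?addr0 // => u.
by rewrite oE => /negPf ->; rewrite mul0r.
Qed.

Lemma nrm2_oracle n m (s : {perm bits n}) (v : vec (qstate n m)) :
  nrm2 (apply_op (oracle s) v) = nrm2 v.
Proof.
rewrite /nrm2 [RHS](reindex_inj (inv_inj (@orcK n m s))) /=.
by apply: eq_bigr => t _; rewrite apply_oracle.
Qed.

Definition differ n m (s s' : {perm bits n}) (t : qstate n m) : bool :=
  let: (x, _, b, _) := t in tau s b x != tau s' b x.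

Lemma differ_orc n m (s s' r : {perm bits n}) (t : qstate n m) :
  differ s s' (orc r t) = differ s s' t.
Proof. by case: t => [[[x z] b] w]. Qed.

(** Where the oracles agree the difference vanishes; elsewhere its square is at most twice the sum
    of the two squares. Either oracle permutes the basis states where they differ, so both squares
    have the same sum, whence the factor 4. *)
Lemma nrm2_oracleB n m (s s' : {perm bits n}) (v : vec (qstate n m)) :
  nrm2 (fun t => apply_op (oracle s') v t - apply_op (oracle s) v t)
    <= 4 * \sum_t (differ s s' t)%:R * sqnorm (v t).
Proof.
pose f t := (differ s s' t)%:R * sqnorm (v t).
have E r : \sum_t f t = \sum_t f (orc r t).
  by rewrite (reindex_inj (inv_inj (@orcK n m r))).
have -> : 4 * \sum_t f t = 2 * \sum_t f (orc s' t) + 2 * \sum_t f (orc s t).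
  by rewrite -!E; ring.
rewrite !mulr_sumr -big_split /=; apply: ler_sum => t _.
rewrite !apply_oracle /f !differ_orc.
case: (boolP (differ s s' t)) => [_|].
  have := @sqnormD_le 1 (v (orc s' t)) (- v (orc s t)) ltr01.
  by rewrite sqnormN !mul1r; lra.
case: t => [[[x z] b] w] /=; rewrite negbK => /eqP ->.
by rewrite subrr /sqnorm /= !mul0r; lra.
Qed.

Lemma nrm2_run n T m (A : qalg n T m) s y k : (k <= T)%N ->
  nrm2 (run_state A s y k) = 1.
Proof.
elim: k => [|k IH] kT /=; rewrite nrm2_unitary; try exact: qU_unitary.
  rewrite /nrm2 (bigD1 (init_state n m)) //= /basis_vec eqxx big1 => [|t /negPf ->];
    by rewrite /sqnorm /=; ring.
by rewrite nrm2_oracle IH // ltnW.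
Qed.

(* The weights [1 + 1/k] and [1 + k] for the old error and for the error made
   by query [k] make the bound propagate without square roots. *)
Lemma hybrid_bound n T m (A : qalg n T m) s s' y k : (k <= T)%N ->
  nrm2 (fun t => run_state A s' y k t - run_state A s y k t) <=
  k%:R * \sum_(j < k) 4 * \sum_t (differ s s' t)%:R * sqnorm (run_state A s y j t).
Proof.
elim: k => [|k IH] kT.
  by rewrite mul0r /nrm2 big1 // => t _; rewrite subrr /sqnorm /=; ring.
set v := run_state A s y; set v' := run_state A s' y.
(* Up to a unitary, the new difference is the oracle of [s'] applied to the old one, plus the error
   [e] of one query in the unmodified run. *)
pose d t := v' k t - v k t.
pose e t := apply_op (oracle s') (v k) t - apply_op (oracle s) (v k) t.
have -> : nrm2 (fun t => v' k.+1 t - v k.+1 t) =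
    nrm2 (fun t => apply_op (oracle s') d t + e t).
  rewrite -[RHS](nrm2_unitary _ (qU_unitary A y kT)); apply: eq_bigr => t _.
  have -> : v' k.+1 = apply_op (qU A y k.+1) (apply_op (oracle s') (v' k)) by [].
  have -> : v k.+1 = apply_op (qU A y k.+1) (apply_op (oracle s) (v k)) by [].
  rewrite -apply_opB; congr sqnorm; apply: eq_bigr => u _; congr (_ * _).
  by rewrite /e /d !apply_oracle; ring.
have He := nrm2_oracleB s s' (v k).
rewrite big_ord_recr /=; set Z := \sum_(j < k) _; set z := 4 * _.
have {}IH : nrm2 (apply_op (oracle s') d) <= k%:R * Z.
  by rewrite nrm2_oracle; apply: IH; exact: ltnW.
have Z0 : 0 <= z by apply: le_trans He; exact: nrm2_ge0.
(* At [k = 0] the weight [1 + 1/k] is undefined, but both runs are still equal, so only [e]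
   remains. *)
case: k @v @v' @d @e {kT} He @Z IH @z Z0 => [|k] v v' d e He Z IH z Z0.
  rewrite /Z big_ord0 add0r mul1r; apply: le_trans He; rewrite /nrm2.
  apply: ler_sum => t _; rewrite apply_oracle /d /v /v' /= subrr add0r //.
set K : RR := k.+1%:R; have K0 : 0 < K by rewrite ltr0n.
rewrite -(ler_pM2l K0) (natrD _ 1) -/K.
have step : K * nrm2 (fun t => apply_op (oracle s') d t + e t) <=
    (K + 1) * nrm2 (apply_op (oracle s') d) + K * (K + 1) * nrm2 e.
  rewrite /nrm2 !mulr_sumr -big_split /=; apply: ler_sum => t _.
  exact: sqnormD_le.
apply: (le_trans step).
have : (K + 1) * nrm2 (apply_op (oracle s') d) <= (K + 1) * (K * Z).
  by rewrite ler_pM2l //; lra.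
have : K * (K + 1) * nrm2 e <= K * (K + 1) * z.
  by rewrite ler_pM2l // mulr_gt0 //; lra.
by lra.
Qed.

Lemma accept_prob_ge0 n T m (A : qalg n T m) s y : 0 <= accept_prob A s y.
Proof. by apply: sumr_ge0 => t _; exact: sqnorm_ge0. Qed.

Lemma accept_prob_le1 n T m (A : qalg n T m) s y : accept_prob A s y <= 1.
Proof.
rewrite -(nrm2_run A s y (leqnn T)) /nrm2 (bigID (mem (qacc A y))) /= lerDl.
by apply: sumr_ge0 => t _; exact: sqnorm_ge0.
Qed.

(** For [k = 24] the weights are 25/24 and 25; as a probability is at most 1, the excess factor
    costs only 1/24. *)
Lemma accept_prob_perturb n T m (A : qalg n T m) s s' y :
  accept_prob A s' y <= accept_prob A s y + 1 / 24 + 25 *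
  (T%:R * \sum_(j < T) 4 *
     \sum_t (differ s s' t)%:R * sqnorm (run_state A s y j t)).
Proof.
have H := hybrid_bound A s s' y (leqnn T).
set Z := T%:R * _ in H *.
have H1 : accept_prob A s' y <= 25 / 24 * accept_prob A s y + 25 *
    nrm2 (fun t => run_state A s' y T t - run_state A s y T t).
  rewrite /nrm2 (bigID (mem (qacc A y))) /= /accept_prob.
  apply: (@le_trans _ _ (\sum_(t in qacc A y) (25 / 24 * sqnorm (run_state A s y T t)
     + 25 * sqnorm (run_state A s' y T t - run_state A s y T t)))).
    apply: ler_sum => t _.
    have := @sqnormD_le 24 (run_state A s y T t)
              (run_state A s' y T t - run_state A s y T t).
    by rewrite addrC subrK => /(_ ltac:(lra)); lra.
  rewrite big_split /= -!mulr_sumr mulrDr addrA lerDl mulr_ge0 //.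
    by apply: sumr_ge0 => t _; exact: sqnorm_ge0.
have := accept_prob_le1 A s y; lra.
Qed.

(** * Comparison of the two input distributions *)

Lemma sum_choices (V : nmodType) a b (F : seq bool -> V) :
  \sum_(w : {ffun 'I_(a + b).+1 -> bool}) F (fgraph w) =
  \sum_c0 \sum_(w1 : a.-tuple bool) \sum_(w2 : b.-tuple bool)
    F (c0 :: w1 ++ rev w2).
Proof.
pose str (c : bool * (a.-tuple bool * b.-tuple bool)) := c.1 :: c.2.1 ++ rev c.2.2.
pose h c : {ffun 'I_(a + b).+1 -> bool} := [ffun i : 'I_(a + b).+1 => nth false (str c) i].
have size_str c : size (str c) = (a + b).+1.
  by rewrite /= size_cat size_rev !size_tuple.
have hK c : fgraph (h c) = str c :> seq bool.
  rewrite /h fgraph_codom /codom_tuple /= codomE.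
  under eq_map => i do rewrite ffunE.
  apply: (@eq_from_nth _ false) => [|i].
    by rewrite size_map -cardE card_ord size_str.
  rewrite size_map -cardE card_ord => il.
  by rewrite (nth_map ord0) -?cardE ?card_ord // nth_enum_ord.
have h_inj : injective h.
  move=> [c0 [w1 w2]] [c0' [w1' w2']] e.
  have := hK (c0, (w1, w2)); rewrite e hK => -[/= -> /eqP].
  rewrite eqseq_cat ?size_tuple // => /andP[/eqP /val_inj -> /eqP /(inv_inj revK)].
  by move/val_inj ->.
have h_bij : bijective h.
  apply: inj_card_bij h_inj _.
  by rewrite card_ffun !card_prod !card_tuple card_bool card_ord expnS expnD.
rewrite (reindex h); last exact: onW_bij.
under eq_bigr => c _ do rewrite hK.
rewrite -(pair_bigA _ (fun c0 w => F (str (c0, w)))) /=.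
by apply: eq_bigr => c0 _; rewrite -(pair_bigA _ (fun w1 w2 => F (str (c0, (w1, w2))))).
Qed.

Lemma sum_D_sigma n l (s : {perm bits n}) (f : bits n -> RR) :
  \sum_y D_sigma l s y * f y =
  (2 ^ l)%:R^-1 * \sum_(w : {ffun 'I_l -> bool}) f (walk s w).
Proof.
rewrite (partition_big (@walk n l s) predT) //= mulr_sumr; apply: eq_bigr => y _.
rewrite /D_sigma mulrAC mulrC; congr (_ * _).
rewrite (eq_bigr (fun=> f y)) => [|w /eqP -> //].
by rewrite sumr_const mulr_natl cardsE.
Qed.

Section Transfer.
Variable n : nat.
Local Notation B := (bits n).
Local Notation N := (#|bits n|).
Local Notation M := (#|{perm bits n}|).

(** The factor [N] counts the choices of [p]. [unwire] sends good pairs injectively to pairs whose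
    rewiring gives back [s], with [y] the end of its walk; a bad pair contributes at most 1. *)
Lemma sum_walk_le_rewire (f : {perm B} -> B -> RR) (c0 : bool) (w1 w2 : seq bool) :
  (forall s y, 0 <= f s y <= 1) ->
  N%:R * \sum_s f s (walk_from s (c0 :: w1 ++ rev w2) (zero_str n)) <=
  \sum_s \sum_y f (rewire s c0 w1 w2 y) y +
  #|[set sp : {perm B} * B | ~~ good_pair c0 w1 w2 sp]|%:R.
Proof.
move=> f01.
pose G := [set sp : {perm B} * B | good_pair c0 w1 w2 sp].
pose end_ s := walk_from s (c0 :: w1 ++ rev w2) (zero_str n).
have -> : N%:R * \sum_s f s (end_ s) = \sum_(sp : {perm B} * B) f sp.1 (end_ sp.1).
  rewrite -(pair_bigA _ (fun s (p : B) => f s (end_ s))) /= mulr_sumr.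
  by apply: eq_bigr => s _; rewrite sumr_const mulr_natl.
rewrite (bigID (mem G)) /=; apply: lerD; last first.
  rewrite -sum1_card natr_sum (eq_bigl (fun sp => sp \notin G)) => [|sp]; last by rewrite !inE.
  by apply: ler_sum => sp _; case/andP: (f01 sp.1 (end_ sp.1)).
rewrite (pair_bigA _ (fun s y => f (rewire s c0 w1 w2 y) y)) /=.
apply: (@le_trans _ _ (\sum_(sy in unwire c0 w1 w2 @: G)
    f (rewire sy.1 c0 w1 w2 sy.2) sy.2)).
  rewrite big_imset /=; last exact: unwire_inj.
  apply: ler_sum => -[s p]; rewrite inE => /rewire_unwire /= [-> _].
  by rewrite /end_ walk_from_path.
rewrite [leRHS](bigID (mem (unwire c0 w1 w2 @: G))) /= lerDl.
by apply: sumr_ge0 => sy _; case/andP: (f01 (rewire sy.1 c0 w1 w2 sy.2) sy.2).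
Qed.

(** Each of the two terms of [card_bad_pair] accounts for at most 1/48 of all pairs. *)
Lemma card_bad_pair_le (c0 : bool) (w1 w2 : seq bool) l :
  l = (size w1 + size w2).+1 -> (48 * (l * l) <= N - l)%N ->
  (24 * #|[set sp : {perm B} * B | ~~ good_pair c0 w1 w2 sp]| <= N * M)%N.
Proof.
move=> lE lN; have := @card_bad_pair n c0 w1 w2 l lE.
set bad := #|_|; move=> h.
have l0 : (0 < l)%N by rewrite lE.
have g0 : (0 < N - l)%N by apply: leq_trans lN; rewrite !muln_gt0 l0.
rewrite -(leq_pmul2r g0).
have h1 : (48 * l <= N)%N.
  apply: leq_trans (leq_subr l _); apply: leq_trans lN.
  by rewrite leq_mul2l leq_pmulr.
have h2 : (N * (l * l * M) * 48 <= N * M * (N - l))%N.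
  have -> : (N * (l * l * M) * 48 = N * M * (48 * (l * l)))%N by lia.
  by rewrite leq_mul2l lN orbT.
have h3 : (l * M * (N - l) * 48 <= N * M * (N - l))%N.
  have -> : (l * M * (N - l) * 48 = 48 * l * (M * (N - l)))%N by lia.
  by rewrite -[leqRHS]mulnA leq_mul2r h1 orbT.
lia.
Qed.

(** Only the inputs [u] and the preimage of [v] are moved. A query in either direction is read as an
    input of [s] with its output: the input is compared with [u], the output with [v]. *)
Lemma differ_rewire m (s : {perm B}) (c0 : bool) (w1 w2 : seq bool) y (t : qstate n m) :
  (differ s (rewire s c0 w1 w2 y) t <=
   (fwd_mid s c0 w1 == if t.1.2 then t.1.1.1 else (s^-1)%g t.1.1.1) +
   (bwd_mid s y w2 == if t.1.2 then s t.1.1.1 else t.1.1.1))%N.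
Proof.
case: t => [[[x z] b] w] /=; rewrite /rewire.
set u := fwd_mid _ _ _; set v := bwd_mid _ _ _.
case: (u =P _) => [_|/eqP ux]; first exact: leq_trans (leq_b1 _) (leq_addr _ 1).
case: (v =P _) => [_|/eqP vx]; first exact: leq_b1.
rewrite leqn0 eqb0 negbK; rewrite /tau eq_sym; case: b ux vx => /= ux vx.
  rewrite permM tpermD //; apply: contraNneq vx => <-; by rewrite permKV.
rewrite invMg tpermV permM tpermD //.
by rewrite (inj_eq perm_inj).
Qed.

(** For a fixed basis state, [fwd_mid] depends only on [w1] and [bwd_mid] only on [w2], so each
    fibre is counted with the other sequence free. *)
Lemma sum_differ_rewire a b m (s : {perm B}) (c0 : bool) y (t : qstate n m) :
  (\sum_(w1 : a.-tuple bool) \sum_(w2 : b.-tuple bool)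
     differ s (rewire s c0 w1 w2 y) t <=
   2 ^ b * (1 + collisions s (start n c0) a) +
   2 ^ a * (1 + collisions (s^-1)%g y b))%N.
Proof.
set x1 := if t.1.2 then t.1.1.1 else (s^-1)%g t.1.1.1.
set x2 := if t.1.2 then s t.1.1.1 else t.1.1.1.
apply: (@leq_trans (\sum_(w1 : a.-tuple bool) \sum_(w2 : b.-tuple bool)
   ((fwd_mid s c0 w1 == x1) + (bwd_mid s y w2 == x2)))).
  by apply: leq_sum => w1 _; apply: leq_sum => w2 _; exact: differ_rewire.
under eq_bigr => w1 _ do rewrite big_split /= sum_nat_const card_tuple card_bool.
rewrite big_split /= sum_nat_const card_tuple card_bool -big_distrr /=.
have fib k (g : k.-tuple bool -> B) x : (\sum_w (g w == x) = #|[set w | g w == x]|)%N.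
  by rewrite -sum1_card [RHS]big_mkcond; apply: eq_bigr => w _; rewrite inE; case: eqP.
rewrite !fib leq_add // leq_mul2l; apply/orP; right.
  apply: leq_trans (card_fiber_le _ _) _; rewrite leq_add2l; apply: eq_leq.
  by apply: eq_card => -[w w']; rewrite !inE /fwd_mid !size_tuple.
apply: leq_trans (card_fiber_le _ _) _; rewrite leq_add2l; apply: eq_leq.
by apply: eq_card => -[w w']; rewrite !inE /bwd_mid !size_tuple.
Qed.

(** With at most one collision on average, the fibre bound of [card_fiber_le] averages to at most
    2. *)
Lemma sum_collisions_le q k : (0 < n)%N ->
  (2 ^ k * 2 ^ k * (k.*2 * k.*2) < N - k.*2)%N ->
  (\sum_(s : {perm B}) collisions s q k <= M)%N.
Proof.
move=> n0 kN; have g0 : (0 < N - k.*2)%N by exact: leq_ltn_trans kN.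
rewrite -(leq_pmul2r g0); apply: leq_trans (sum_collisions q k n0) _.
by rewrite mulnA mulnC leq_mul2l (ltnW kN) orbT.
Qed.

End Transfer.

(** The weights come from the run on the unmodified [s], which does not depend on [w1] and [w2]. So
    the choices can be summed first, and the squared amplitudes add up to 1 at each query. *)
Lemma sum_query_weight n a b T m (A : qalg n T m) (s : {perm bits n}) (c0 : bool) y :
  \sum_(w1 : a.-tuple bool) \sum_(w2 : b.-tuple bool) \sum_(j < T) 4 *
     \sum_t (differ s (rewire s c0 w1 w2 y) t)%:R * sqnorm (run_state A s y j t)
  <= 4 * T%:R * (2 ^ b * (1 + collisions s (start n c0) a) +
                 2 ^ a * (1 + collisions (s^-1)%g y b))%N%:R.
Proof.
set C := (2 ^ b * _ + _)%N.
under eq_bigr => w1 _ do rewrite exchange_big /=.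
rewrite exchange_big /=.
apply: (@le_trans _ _ (\sum_(j < T) 4 * C%:R)); last first.
  by rewrite sumr_const card_ord -mulr_natl; lra.
apply: ler_sum => j _.
under eq_bigr => w1 _ do rewrite -mulr_sumr exchange_big /=.
rewrite -mulr_sumr exchange_big /= ler_pM2l ?ltr0n //.
have -> : C%:R = \sum_t C%:R * sqnorm (run_state A s y j t).
  by rewrite -mulr_sumr -/(nrm2 _) nrm2_run ?mulr1 // ltnW.
apply: ler_sum => t _.
under eq_bigr => w1 _ do rewrite -mulr_suml.
rewrite -mulr_suml ler_wpM2r ?sqnorm_ge0 //.
under eq_bigr => w1 _ do rewrite -natr_sum.
by rewrite -natr_sum ler_nat sum_differ_rewire.
Qed.

Lemma card_bits n : #|bits n| = (2 ^ n)%N.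
Proof. by rewrite card_ffun card_bool card_ord. Qed.

Lemma sum_rewire_accept n a b T m (A : qalg n T m) : (0 < n)%N -> (a <= b)%N ->
  (2 ^ b * 2 ^ b * (b.*2 * b.*2) < 2 ^ n - b.*2)%N ->
  \sum_(c0 : bool) \sum_(w1 : a.-tuple bool) \sum_(w2 : b.-tuple bool)
    \sum_(s : {perm bits n}) \sum_y accept_prob A (rewire s c0 w1 w2 y) y <=
  (2 ^ (a + b).+1)%:R *
    (\sum_(s : {perm bits n}) \sum_y accept_prob A s y +
     (#|{perm bits n}| * 2 ^ n)%:R * (1 / 24 + 400 * T%:R ^+ 2 / (2 ^ a)%:R)).
Proof.
move=> n0 ab bN; set M := #|{perm bits n}|.
pose W s c0 (w1 : a.-tuple bool) (w2 : b.-tuple bool) y : RR := \sum_(j < T) 4 *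
     \sum_t (differ s (rewire s c0 w1 w2 y) t)%:R * sqnorm (run_state A s y j t).
have aN : (2 ^ a * 2 ^ a * (a.*2 * a.*2) < 2 ^ n - a.*2)%N.
  have ab2 : (a.*2 <= b.*2)%N by rewrite leq_double.
  have e2 : (2 ^ a <= 2 ^ b)%N by rewrite leq_exp2l.
  apply: leq_ltn_trans (leq_trans bN _); first by rewrite !leq_mul.
  exact: leq_sub2l.
apply: (@le_trans _ _ (\sum_(c0 : bool) \sum_(w1 : a.-tuple bool) \sum_(w2 : b.-tuple bool)
    \sum_(s : {perm bits n}) \sum_y
      ((accept_prob A s y + 1 / 24) + 25 * (T%:R * W s c0 w1 w2 y)))).
  do 5 (apply: ler_sum => ? _); exact: accept_prob_perturb.
pose S1 := \sum_(s : {perm bits n}) \sum_y (accept_prob A s y + 1 / 24).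
have -> : \sum_(c0 : bool) \sum_(w1 : a.-tuple bool) \sum_(w2 : b.-tuple bool)
    \sum_(s : {perm bits n}) \sum_y
      ((accept_prob A s y + 1 / 24) + 25 * (T%:R * W s c0 w1 w2 y)) =
   (2 ^ (a + b).+1)%:R * S1 + 25 * T%:R * \sum_(c0 : bool) \sum_(s : {perm bits n})
     \sum_y \sum_(w1 : a.-tuple bool) \sum_(w2 : b.-tuple bool) W s c0 w1 w2 y.
  have -> : (2 ^ (a + b).+1)%:R * S1 =
      \sum_(c0 : bool) \sum_(w1 : a.-tuple bool) \sum_(w2 : b.-tuple bool) S1.
    rewrite !sumr_const !card_tuple card_bool -!mulrnA mulr_natl; congr (_ *+ _).
    by rewrite expnS expnD; lia.
  rewrite mulr_sumr -big_split /=; apply: eq_bigr => c0 _.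
  have -> : \sum_(s : {perm bits n}) \sum_y \sum_(w1 : a.-tuple bool)
       \sum_(w2 : b.-tuple bool) W s c0 w1 w2 y =
     \sum_(w1 : a.-tuple bool) \sum_(w2 : b.-tuple bool)
       \sum_(s : {perm bits n}) \sum_y W s c0 w1 w2 y.
    under eq_bigr => s _ do rewrite exchange_big /=.
    rewrite exchange_big /=; apply: eq_bigr => w1 _.
    under eq_bigr => s _ do rewrite exchange_big /=.
    by rewrite exchange_big.
  rewrite mulr_sumr -big_split /=; apply: eq_bigr => w1 _.
  rewrite mulr_sumr -big_split /=; apply: eq_bigr => w2 _.
  rewrite mulr_sumr -big_split /=; apply: eq_bigr => s _.
  rewrite mulr_sumr -big_split /=; apply: eq_bigr => y _.
  by rewrite mulrA.
have S1E : S1 = \sum_(s : {perm bits n}) \sum_y accept_prob A s y + (M * 2 ^ n)%:R / 24.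
  rewrite /S1; under eq_bigr => s _ do rewrite big_split /= sumr_const card_bits.
  rewrite big_split /= sumr_const -mulrnA -mulr_natr -/M; congr (_ + _).
  by rewrite mulnC; lra.
have cM c0 : (\sum_(s : {perm bits n}) collisions s (start n c0) a <= M)%N.
  by apply: sum_collisions_le; rewrite ?card_bits.
have cM' y : (\sum_(s : {perm bits n}) collisions (s^-1)%g y b <= M)%N.
  have <- : (\sum_(s : {perm bits n}) collisions s y b =
      \sum_(s : {perm bits n}) collisions (s^-1)%g y b)%N.
    exact: (reindex_inj invg_inj).
  by apply: sum_collisions_le; rewrite ?card_bits.
(* Each [1 + collisions] averages to at most 2, and [a <= b] lets [2 ^ b] dominate, giving the
   factor 2 + 2 = 4. *)
have Cle c0 : (\sum_(s : {perm bits n}) \sum_y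
    (2 ^ b * (1 + collisions s (start n c0) a) + 2 ^ a * (1 + collisions (s^-1)%g y b))
    <= 2 ^ b * 4 * (M * 2 ^ n))%N.
  rewrite exchange_big /=.
  apply: (@leq_trans (\sum_(y : bits n) (2 ^ b * (M + M) + 2 ^ a * (M + M)))).
    apply: leq_sum => y _; rewrite big_split -!big_distrr !big_split /= sum1_card.
    by rewrite leq_add // leq_mul2l leq_add2l ?cM ?cM' orbT.
  rewrite sum_nat_const card_bits.
  have e2 : (2 ^ a <= 2 ^ b)%N by rewrite leq_exp2l.
  have : (2 ^ a * (M + M) <= 2 ^ b * (M + M))%N by rewrite leq_mul2r e2 orbT.
  move=> h; apply: (@leq_trans (2 ^ n * (2 ^ b * (M + M) + 2 ^ b * (M + M)))).
    by rewrite leq_mul2l leq_add2l h orbT.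
  lia.
have Wle : \sum_(c0 : bool) \sum_(s : {perm bits n})
     \sum_y \sum_(w1 : a.-tuple bool) \sum_(w2 : b.-tuple bool) W s c0 w1 w2 y
   <= 2 * (4 * T%:R * (2 ^ b * 4 * (M * 2 ^ n))%:R).
  apply: (@le_trans _ _ (\sum_(c0 : bool) 4 * T%:R * (2 ^ b * 4 * (M * 2 ^ n))%:R));
    last by rewrite sumr_const card_bool; lra.
  apply: ler_sum => c0 _.
  apply: (@le_trans _ _ (\sum_(s : {perm bits n}) \sum_(y : bits n) 4 * T%:R *
    (2 ^ b * (1 + collisions s (start n c0) a) +
     2 ^ a * (1 + collisions (s^-1)%g y b))%N%:R)).
    by do 2 (apply: ler_sum => ? _); exact: sum_query_weight.
  under eq_bigr => s _ do rewrite -mulr_sumr -natr_sum.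
  rewrite -mulr_sumr -natr_sum ler_wpM2l ?ler_nat ?Cle //.
  by rewrite mulr_ge0 // ler0n.
rewrite S1E expnS expnD !natrM.
set a2 : RR := (2 ^ a)%:R; set b2 : RR := (2 ^ b)%:R.
have a2_gt0 : 0 < a2 by rewrite ltr0n expn_gt0.
have T0 : 0 <= 25 * T%:R :> RR by rewrite mulr_ge0 // ler0n.
have := ler_wpM2l T0 Wle; rewrite !natrM -/b2.
set Q := \sum_c0 _; set P := \sum_s _; set Mr : RR := M%:R; set N : RR := (2 ^ n)%:R.
set t : RR := T%:R => h.
(* 800 is the product of 25 from [accept_prob_perturb], 2 for the bit [c0], 4 from the oracle
   difference and 4 from [Cle]; division by [2 ^ (a + b).+1] leaves [400 / 2 ^ a]. *)
have -> : 2%:R * (a2 * b2) * (P + Mr * N * (1 / 24 + 400 * t ^+ 2 / a2)) =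
  2%:R * (a2 * b2) * (P + Mr * N / 24) + 800 * t ^+ 2 * b2 * Mr * N.
  by field; rewrite gt_eqF.
rewrite lerD2l; apply: (le_trans h).
by lra.
Qed.

Lemma success_U_eq n T m (A : qalg n T m) :
  success_U A = 1 - (#|{perm bits n}| * 2 ^ n)%:R^-1 *
    \sum_(s : {perm bits n}) \sum_y accept_prob A s y.
Proof.
have M0 : #|{perm bits n}|%:R != 0 :> RR.
  by rewrite pnatr_eq0 -lt0n; apply/card_gt0P; exists 1%g.
have N0 : (2 ^ n)%:R != 0 :> RR by rewrite pnatr_eq0 expn_eq0.
rewrite /success_U /unif.
under eq_bigr => s _ do rewrite -mulr_sumr sumrB sumr_const card_bits.
rewrite -mulr_sumr sumrB sumr_const natrM -mulrnA mulnC -mulr_natr mul1r natrM.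
by field; rewrite N0.
Qed.

(** One 1/24 comes from bad pairs, another from [accept_prob_perturb]; the mean acceptance [P]
    cancels against the uniform case. *)
Lemma advantage_bound n a b T m (A : qalg n T m) : (0 < n)%N -> (a <= b)%N ->
  (2 ^ b * 2 ^ b * (b.*2 * b.*2) < 2 ^ n - b.*2)%N ->
  (48 * ((a + b).+1 * (a + b).+1) <= 2 ^ n - (a + b).+1)%N ->
  success_D (a + b).+1 A + success_U A <=
    1 + (1 / 12 + 400 * T%:R ^+ 2 / (2 ^ a)%:R).
Proof.
move=> n0 ab bN lN; rewrite success_U_eq; set M := #|{perm bits n}|.
set l := (a + b).+1 in lN *.
set P := \sum_s _.
pose walkE c0 (w1 : a.-tuple bool) (w2 : b.-tuple bool) s :=
  walk_from s (c0 :: w1 ++ rev w2) (zero_str n).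
have DE : success_D l A = M%:R^-1 * ((2 ^ l)%:R^-1 *
    \sum_(c0 : bool) \sum_(w1 : a.-tuple bool) \sum_(w2 : b.-tuple bool)
      \sum_s accept_prob A s (walkE c0 w1 w2 s)).
  rewrite /success_D; congr (_ * _).
  under eq_bigr => s _ do rewrite sum_D_sigma.
  rewrite -mulr_sumr exchange_big /=; congr (_ * _).
  exact: (sum_choices a b (fun ws => \sum_s accept_prob A s (walk_from s ws (zero_str n)))).
have M0 : 0 < M%:R :> RR by rewrite ltr0n; apply/card_gt0P; exists 1%g.
have N0 : 0 < (2 ^ n)%:R :> RR by rewrite ltr0n expn_gt0.
have L0 : 0 < (2 ^ l)%:R :> RR by rewrite ltr0n expn_gt0.
have step : (2 ^ n)%:R * (\sum_(c0 : bool) \sum_(w1 : a.-tuple bool)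
     \sum_(w2 : b.-tuple bool) \sum_s accept_prob A s (walkE c0 w1 w2 s)) <=
  \sum_(c0 : bool) \sum_(w1 : a.-tuple bool) \sum_(w2 : b.-tuple bool)
    (\sum_(s : {perm bits n}) \sum_y accept_prob A (rewire s c0 w1 w2 y) y +
     (M * 2 ^ n)%:R / 24).
  do 3 (rewrite mulr_sumr; apply: ler_sum => ? _).
  rewrite -card_bits; apply: le_trans (sum_walk_le_rewire _ _ _ _) _.
    by move=> s y; rewrite accept_prob_ge0 accept_prob_le1.
  rewrite lerD2l ler_pdivlMr ?ltr0n // -natrM ler_nat mulnC [leqRHS]mulnC.
  by apply: (@card_bad_pair_le _ _ _ _ l); rewrite ?size_tuple ?card_bits.
have rw := sum_rewire_accept A n0 ab bN.
have {}step : (2 ^ n)%:R * (\sum_(c0 : bool) \sum_(w1 : a.-tuple bool)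
     \sum_(w2 : b.-tuple bool) \sum_s accept_prob A s (walkE c0 w1 w2 s)) <=
  (2 ^ l)%:R * (P + (M * 2 ^ n)%:R * (1 / 12 + 400 * T%:R ^+ 2 / (2 ^ a)%:R)).
  apply: (le_trans step); rewrite -/M -/P -/l in rw.
  under eq_bigr => c0 _ do
    (under eq_bigr => w1 _ do rewrite big_split /= sumr_const card_tuple card_bool;
     rewrite big_split /= sumr_const card_tuple card_bool).
  rewrite big_split /= sumr_const card_bool -!mulrnA.
  have -> : (M * 2 ^ n)%:R / 24 *+ (2 ^ b * (2 ^ a * 2)) =
     (2 ^ l)%:R * ((M * 2 ^ n)%:R / 24) :> RR.
    rewrite -mulr_natl; congr (_%:R * _); rewrite /l expnS expnD; lia.
  by apply: (le_trans (lerD rw (lexx _))); rewrite -mulrDr; lra.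
rewrite DE; set Z := \sum_c0 _ in step *.
set E := 1 / 12 + _ in step *.
rewrite addrCA lerD2l lerBlDr natrM.
have -> : E + (M%:R * (2 ^ n)%:R)^-1 * P =
   M%:R^-1 * ((2 ^ l)%:R^-1 * ((2 ^ n)%:R^-1 * ((2 ^ l)%:R * (P + (M * 2 ^ n)%:R * E)))).
  by rewrite natrM; field; rewrite !gt_eqF.
rewrite ler_pM2l ?invr_gt0 // ler_pM2l ?invr_gt0 // mulrC ler_pdivlMr //.
by rewrite mulrC.
Qed.

(** * Choice of the parameters *)

Lemma size_conditions n l a b : (4 * l + 10 <= n)%N -> l = (a + b).+1 ->
  (2 ^ b * 2 ^ b * (b.*2 * b.*2) < 2 ^ n - b.*2)%N /\
  (48 * (l * l) <= 2 ^ n - l)%N.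
Proof.
move=> ln lE; set X := (2 ^ l)%N.
have lX : (l < X)%N by exact: ltn_expl.
have bX : (2 ^ b <= X)%N by rewrite leq_exp2l // lE; lia.
(* The products to be bounded are at most [4 * X ^ 4] and [48 * X ^ 2], and the subtracted terms are
   at most [2 * X]. *)
have nX : (1024 * (X * X * (X * X)) <= 2 ^ n)%N.
  apply: leq_trans (leq_pexp2l (isT : 0 < 2)%N ln).
  rewrite expnD [leqRHS]mulnC; apply: leq_mul => //.
  by rewrite /X -!expnD leq_exp2l //; lia.
have b2X : (b.*2 <= 2 * X)%N by lia.
have X1 : (1 <= X)%N by rewrite expn_gt0.
have X2 : (X <= X * X)%N by rewrite leq_pmulr.
have X4 : (X * X <= X * X * (X * X))%N by rewrite leq_pmulr // muln_gt0 X1.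
split.
  have : (2 ^ b * 2 ^ b * (b.*2 * b.*2) <= X * X * (2 * X * (2 * X)))%N.
    by rewrite !leq_mul.
  lia.
have : (l * l <= X * X)%N by rewrite leq_mul // ltnW.
lia.
Qed.

Lemma Rpower2_sqr_le (c : RR) (l a : nat) :
  2 * (c * l%:R) <= a.+1%:R -> Rpower 2 (c * l%:R) ^+ 2 <= 2 * (2 ^ a)%:R.
Proof.
move=> h.
have -> : 2 * (2 ^ a)%:R = Rpower 2 (a.+1%:R) :> RR.
  rewrite -(INRE a.+1) Rpower_pow; last by apply/RltP; exact: (ltr0Sn RR 1).
  by rewrite RpowE natrX exprS.
rewrite expr2 -RmultE -Rpower_plus; apply/RleP; apply: Rle_Rpower; apply/RleP.
  have h12 : 1 <= 2 :> RR by lra.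
  exact: h12.
by rewrite RplusE; lra.
Qed.

Theorem theorem1 (ell : nat -> nat)
  (ell_pos : forall n : nat, (0 < ell n)%N)
  (ell_o_n : forall eps : RR, 0 < eps ->
     exists N : nat, forall n : nat, (N <= n)%N -> (ell n)%:R <= eps * n%:R) :
  exists c : RR, 0 < c /\
  exists N : nat, forall n : nat, (0 < n)%N -> (N <= n)%N ->
    forall (T m : nat) (A : qalg n T m),
      2 / 3 < success_D (ell n) A ->
      2 / 3 < success_U A ->
      c * Rpower 2 (c * (ell n)%:R) <= T%:R.
Proof.
(* The value 1/8 gives [8 * ell n <= n], which with [n >= 20] yields the hypothesis of
   [size_conditions]. *)
have [N0 hN0] := ell_o_n (1 / 8) ltac:(lra).
(* As an exponent, 1/100 satisfies [2 * (c * l) <= a.+1] because [l <= 2 * a.+1]; as a factor, twice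
   its square is below the 1/1600 coming from [adv]. *)
exists (1 / 100); split; first by lra.
exists (maxn N0 20) => n n0; rewrite geq_max => /andP[/hN0 ln n20] T m A.
have {}ln : (4 * ell n + 10 <= n)%N.
  suff : (8 * ell n <= n)%N by lia.
  by rewrite -(ler_nat RR) natrM; lra.
move: (ell n) (ell_pos n) ln => l l0 ln hD hU.
(* Halve the [l - 1] choices after the first, rounding [a] down so that [a <= b]. *)
pose a := l.-1./2; pose b := (l.-1 - a)%N.
have lE : l = (a + b).+1 by rewrite /b /a; lia.
have ab : (a <= b)%N by rewrite /b /a; lia.
have [c1 c2] := size_conditions ln lE.
rewrite lE in c2 hD.
have := advantage_bound A n0 ab c1 c2; set t : RR := T%:R; set a2 : RR := (2 ^ a)%:R.
move=> adv; have a2_gt0 : 0 < a2 by rewrite ltr0n expn_gt0.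
(* The two success probabilities add up to more than 4/3, and 4/3 - 1 - 1/12 = 1/4. *)
have {}adv : a2 < 1600 * t ^+ 2.
  have : 1 / 4 < 400 * t ^+ 2 / a2 by lra.
  by rewrite ltr_pdivlMr //; lra.
have r2 : Rpower 2 (1 / 100 * l%:R) ^+ 2 <= 2 * a2.
  apply: Rpower2_sqr_le.
  have : l%:R <= 2 * a.+1%:R :> RR by rewrite -natrM ler_nat /a; lia.
  by have : 0 <= a.+1%:R :> RR by []; lra.
set r := Rpower _ _ in r2 *.
have t0 : 0 <= t by exact: ler0n.
rewrite leNgt; apply/negP => tr.
have : t ^+ 2 < (1 / 100 * r) ^+ 2 by rewrite ltr_pXn2r // nnegrE; lra.
by rewrite exprMn; lra.
Qed.
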